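(* Let $n\ge 3$ and let two non-congruent regular $n$-gons be given in the plane, with circumradii $R_1$ and $R_2$. Then the two polygons can be positioned in the plane (each being moved by a rigid motion of the plane) so that there is a point $M$ in the plane at equal distances from the vertices of the two polygons; that is, after a suitable enumeration of the vertices $A_1,\dots,A_n$ of the first polygon and $B_1,\dots,B_n$ of the second polygon, $MA_k=MB_k$ for all $k=1,\dots,n$. Denoting by $O_1,O_2$ the centroids of the polygons so positioned, such a point $M$ satisfies: (I) $M$ lies on the intersection of the circle with center $O_2$ and radius $R_1$ and the circle with center $O_1$ and radius $R_2$, i.e. $MO_2=R_1$ and $MO_1=R_2$; (II) one pair of distances is equal, $MA_1=MB_1$; for a point $M$ as in (I), this can be achieved by rotating one of the polygons about its centroid.
   Context: For points $X,Y$ of the Euclidean plane, $XY$ denotes their distance. The circumradius of a regular polygon is the radius of its circumscribed circle; its centroid is the center of that circle. *)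

(* Defs.v *)
From mathcomp Require Import all_boot all_order all_algebra.
From mathcomp Require Import all_classical all_reals all_analysis.

Set Implicit Arguments.
Unset Strict Implicit.
Unset Printing Implicit Defensive.
Import Order.TTheory GRing.Theory Num.Theory.
Import numFieldNormedType.Exports.
Local Open Scope classical_set_scope.
Local Open Scope ring_scope.

(* The library norm on [R * R] is the max norm, hence this explicit definition
   of the Euclidean distance. *)
Definition euclid_dist (R : realType) (x y : R * R) : R :=
  Num.sqrt ((x.1 - y.1) ^+ 2 + (x.2 - y.2) ^+ 2).

Definition circle (R : realType) (O : R * R) (r : R) : set (R * R) :=
  [set x | euclid_dist x O = r].

(* Counterclockwise, by the angle t. *)
Definition rotation (R : realType) (O : R * R) (t : R) (x : R * R) : R * R :=
  (O.1 + cos t * (x.1 - O.1) - sin t * (x.2 - O.2),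
   O.2 + sin t * (x.1 - O.1) + cos t * (x.2 - O.2)).

(* Reflections are allowed; as a regular polygon is its own mirror image, this
   makes no difference to the positions it can take. *)
Definition rigid_motion (R : realType) (f : R * R -> R * R) : Prop :=
  forall x y, euclid_dist (f x) (f y) = euclid_dist x y.

(* A regular polygon is represented by its set of vertices: [P] consists of n
   points equally spaced on its circumscribed circle, so that [O] is the
   centroid and [r] the circumradius. *)
Definition regular_ngon (R : realType) (n : nat) (O : R * R) (r : R)
    (P : set (R * R)) : Prop :=
  0 < r /\
  exists2 a, circle O r a &
    P = range (fun k : 'I_n => rotation O (2 * pi * k%:R / n%:R) a).

Definition congruent (R : realType) (P Q : set (R * R)) : Prop :=
  exists2 f, rigid_motion f & f @` P = Q.

(* The enumeration need not follow the cyclic order of the vertices. *)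
Definition enumeration (R : realType) (n : nat) (P : set (R * R))
    (A : 'I_n -> R * R) : Prop :=
  injective A /\ range A = P.

(* Vertices are numbered from 0: this is the index of A_1 and B_1. *)
Definition first_index (n : nat) (hn : (3 <= n)%N) : 'I_n :=
  Ordinal (leq_trans (isT : (0 < 3)%N) hn).

(* Main.v *)
(* For a regular n-gon with n >= 3, centroid O and circumradius r, the sums over
   the vertices A_k of MA_k^2 and of MA_k^4 are n S and n (S^2 + 2 p), where
   S = MO^2 + r^2 and p = MO^2 r^2.  So if M is equidistant from two such
   polygons, the pairs {MO_1^2, R_1^2} and {MO_2^2, R_2^2} have the same sum and
   product, hence coincide; as R_1 <> R_2, they are matched crosswise.
   Conversely, if MO_1 = R_2 and MO_2 = R_1, the triangles M O_1 A_k and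
   B_k O_2 M have equal sides at O_1 and O_2, so that MA_k = MB_k reduces to an
   equality of angles, obtained by a rotation. *)
Require Import Defs.
From mathcomp Require Import all_boot all_order all_algebra.
From mathcomp Require Import all_classical all_reals all_analysis.
From mathcomp Require Import ring lra.

Set Implicit Arguments.
Unset Strict Implicit.
Unset Printing Implicit Defensive.
Import Order.TTheory GRing.Theory Num.Theory.
Import numFieldNormedType.Exports.
Local Open Scope classical_set_scope.
Local Open Scope ring_scope.

(** * Distances, circles and angles in coordinates *)

Lemma euclid_dist_ge0 (R : realType) (x y : R * R) : 0 <= euclid_dist x y.
Proof. exact: sqrtr_ge0. Qed.

Lemma sqr_euclid_dist (R : realType) (x y : R * R) :
  euclid_dist x y ^+ 2 = (x.1 - y.1) ^+ 2 + (x.2 - y.2) ^+ 2.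
Proof. by rewrite sqr_sqrtr // addr_ge0 ?sqr_ge0. Qed.

Lemma eq_euclid_dist (R : realType) (x y z t : R * R) :
  (x.1 - y.1) ^+ 2 + (x.2 - y.2) ^+ 2 = (z.1 - t.1) ^+ 2 + (z.2 - t.2) ^+ 2 ->
  euclid_dist x y = euclid_dist z t.
Proof. by rewrite /euclid_dist => ->. Qed.

Lemma circleP (R : realType) (O x : R * R) (r : R) : 0 <= r ->
  circle O r x <-> (x.1 - O.1) ^+ 2 + (x.2 - O.2) ^+ 2 = r ^+ 2.
Proof.
move=> r0; rewrite -sqr_euclid_dist /circle /=; split => [->//|/eqP].
by rewrite eqrXn2 ?euclid_dist_ge0// => /eqP.
Qed.

(** The values of [acos] lie in [[0, pi]], where the sine is nonnegative; a negative [y] calls for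
    the opposite angle. *)
Lemma exists_angle (R : realType) (x y : R) : x ^+ 2 + y ^+ 2 = 1 ->
  exists t, cos t = x /\ sin t = y.
Proof.
move=> xy1.
have x11 : -1 <= x <= 1 by apply/andP; split; nra.
have sqy : Num.sqrt (1 - x ^+ 2) = `|y|.
  by rewrite -sqrtr_sqr; congr Num.sqrt; lra.
have [y0|y0] := leP 0 y.
  by exists (acos x); rewrite acosK ?in_itv//= sin_acos// sqy ger0_norm.
exists (- acos x); rewrite cosN sinN acosK ?in_itv//= sin_acos// sqy.
by rewrite ltr0_norm// opprK.
Qed.

(** * Rotations, rigid motions and congruence *)

Lemma circle_rotation (R : realType) (O x : R * R) (r t : R) : 0 <= r ->
  circle O r x -> circle O r (rotation O t x).
Proof.
move=> r0; rewrite !circleP//= => <-.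
rewrite -[RHS]mul1r -(cos2Dsin2 t); ring.
Qed.

(** Translating [O] to [O'] and turning [a - O] into [a' - O'] is a rigid motion; as plane rotations
    commute, it carries every rotated copy of [a] to the corresponding copy of [a']. *)
Lemma exists_rigid_motion_rotation (R : realType) (O O' a a' : R * R) (r : R) :
  0 < r -> circle O r a -> circle O' r a' ->
  exists2 f, rigid_motion f &
    forall t, f (rotation O t a) = rotation O' t a'.
Proof.
move=> r0 /(circleP _ _ (ltW r0)) ha /(circleP _ _ (ltW r0)) ha'.
have rn0 : r != 0 by rewrite gt_eqF.
pose v1 := a.1 - O.1; pose v2 := a.2 - O.2.
pose w1 := a'.1 - O'.1; pose w2 := a'.2 - O'.2.
rewrite -/v1 -/v2 in ha; rewrite -/w1 -/w2 in ha'.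
(* In complex notation [p + i q] is the quotient [w / v], of modulus 1 because [v] and [w] both have
   length [r]. *)
pose p := (v1 * w1 + v2 * w2) / r ^+ 2.
pose q := (v1 * w2 - v2 * w1) / r ^+ 2.
have pq : p ^+ 2 + q ^+ 2 = 1.
  rewrite /p /q !exprMn -mulrDl.
  have -> : (v1 * w1 + v2 * w2) ^+ 2 + (v1 * w2 - v2 * w1) ^+ 2
    = (v1 ^+ 2 + v2 ^+ 2) * (w1 ^+ 2 + w2 ^+ 2) by ring.
  by rewrite ha ha'; field.
have hw1 : p * v1 - q * v2 = w1.
  have -> : p * v1 - q * v2 = w1 * (v1 ^+ 2 + v2 ^+ 2) / r ^+ 2.
    by rewrite /p /q; field.
  by rewrite ha mulfK// expf_neq0.
have hw2 : q * v1 + p * v2 = w2.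
  have -> : q * v1 + p * v2 = w2 * (v1 ^+ 2 + v2 ^+ 2) / r ^+ 2.
    by rewrite /p /q; field.
  by rewrite ha mulfK// expf_neq0.
exists (fun x => (O'.1 + p * (x.1 - O.1) - q * (x.2 - O.2),
                  O'.2 + q * (x.1 - O.1) + p * (x.2 - O.2))).
  move=> x y; apply: eq_euclid_dist => /=.
  by rewrite -[RHS]mul1r -pq; ring.
move=> t; rewrite /rotation /= -/v1 -/v2 -/w1 -/w2 -hw1 -hw2.
by congr pair; ring.
Qed.

(** With equal circumradii, a rigid motion matching the two starting vertices would match all the
    others as well. *)
Lemma noncongruent_circumradii (R : realType) (n : nat) (P1 P2 : set (R * R))
    (C1 C2 : R * R) (R1 R2 : R) :
  regular_ngon n C1 R1 P1 -> regular_ngon n C2 R2 P2 -> ~ congruent P1 P2 ->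
  R1 <> R2.
Proof.
move=> [R10 [a ha ->]] [_ [b hb ->]] ncong R12; apply: ncong.
rewrite -{}R12 in hb.
have [f rf hf] := exists_rigid_motion_rotation R10 ha hb.
exists f => //; rewrite image_comp.
by apply: eq_imagel => k _ /=; rewrite hf.
Qed.

(** * Vertices and their enumerations *)

Lemma sin_ltpi_neq0 (R : realType) (x : R) : 0 < x < pi -> sin x != 0.
Proof. by move=> x0pi; rewrite gt_eqF// sin_gt0_pi. Qed.

Lemma regular_rotation_inj (R : realType) (n : nat) (O a : R * R) (r : R) :
  0 < r -> circle O r a ->
  injective (fun k : 'I_n => rotation O (2 * pi * k%:R / n%:R) a).
Proof.
move=> r0 /(circleP _ _ (ltW r0)) ha.
suff lt_neq (j k : 'I_n) : (j < k)%N ->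
    rotation O (2 * pi * j%:R / n%:R) a <> rotation O (2 * pi * k%:R / n%:R) a.
  move=> j k /= jk; apply: val_inj; case: (ltngtP j k) => // jk'.
    by case: (lt_neq _ _ jk').
  by case: (lt_neq _ _ jk').
move=> jk [].
set tj := _ / _; set tk := _ / n%:R.
have n_gt0 : (0 < n)%N by rewrite (leq_ltn_trans _ (ltn_ord k)).
have n0 : 0 < n%:R :> R by rewrite ltr0n.
(* Half the angle between two vertices is [pi (k - j) / n], so its sine is nonzero; a coincidence of
   the vertices would make this sine vanish. *)
have d0 : 0 < (tk - tj) / 2 < pi.
  have -> : (tk - tj) / 2 = pi * ((k - j)%:R / n%:R).
    by rewrite /tk /tj natrB 1?ltnW//; field; rewrite gt_eqF.
  rewrite mulr_gt0 ?divr_gt0 ?pi_gt0 ?ltr0n ?subn_gt0//=.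
  rewrite gtr_pMr ?pi_gt0// ltr_pdivrMr// mul1r ltr_nat.
  by rewrite (leq_ltn_trans (leq_subr _ _)).
have /eqP sn0 := sin_ltpi_neq0 d0.
move: ha; set v1 := a.1 - O.1; set v2 := a.2 - O.2 => ha e1 e2; apply: sn0.
have cosd : cos (tk - tj) = 1.
  have r2 : r ^+ 2 != 0 by rewrite expf_neq0// gt_eqF.
  apply: (mulIf r2); rewrite mul1r -ha cosB.
  have {}e1 : cos tj * v1 - sin tj * v2 = cos tk * v1 - sin tk * v2 by lra.
  have {}e2 : sin tj * v1 + cos tj * v2 = sin tk * v1 + cos tk * v2 by lra.
  have h := cos2Dsin2 tk.
  rewrite -[RHS]mul1r -h.
  (* The inner product of the two vertices, seen from [O], is [r ^+ 2 * cos (tk - tj)]; if they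
     coincide it is also the squared length [r ^+ 2]. *)
  transitivity ((cos tj * v1 - sin tj * v2) * (cos tk * v1 - sin tk * v2) +
    (sin tj * v1 + cos tj * v2) * (sin tk * v1 + cos tk * v2)); first by ring.
  by rewrite e1 e2; ring.
have {}cosd : cos ((tk - tj) / 2 *+ 2) = 1.
  by rewrite -[RHS]cosd mulr2n -splitr.
by move: cosd (cos2Dsin2 ((tk - tj) / 2)); rewrite cos_mulr2n; nra.
Qed.

(** Two enumerations of the same vertices differ by a permutation of the indices. Sums over an
    arbitrary enumeration can thus be computed on the cyclic one. *)
Lemma sum_enumeration (R : realType) (V : zmodType) (n : nat)
    (P : set (R * R)) (A B : 'I_n -> R * R) (F : R * R -> V) :
  enumeration P A -> enumeration P B ->
  \sum_(k < n) F (A k) = \sum_(k < n) F (B k).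
Proof.
move=> [Ainj rA] [_ rB].
have AB k : exists j, B j = A k.
  have : range B (A k) by rewrite rB -rA; exists k.
  by move=> [j _ Bj]; exists j.
have [s Bs] := choice AB.
have sinj : injective s by move=> j k sjk; apply: Ainj; rewrite -!Bs sjk.
by rewrite [RHS](reindex_inj sinj); apply: eq_bigr => k _; rewrite Bs.
Qed.

(** * Trigonometric sums and moments of the squared distances *)

Lemma sum_cos_period (R : realType) (a d : R) (m n : nat) : sin (d / 2) != 0 ->
  d * n%:R = 2 * pi * m%:R -> \sum_(k < n) cos (a + d * k%:R) = 0.
Proof.
move=> s0 dn; have s20 : 2 * sin (d / 2) != 0 by rewrite mulf_neq0.
(* 2 sin (d / 2) cos x = sin (x + d / 2) - sin (x - d / 2) makes the sum
   telescope. *)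
apply: (mulfI s20); rewrite mulr0 mulr_sumr.
pose F (k : nat) := sin (a + d * k%:R - d / 2).
rewrite (eq_bigr (fun k : 'I_n => F k.+1 - F k)); last first.
  move=> k _; rewrite /F -(natr1 k).
  have -> : a + d * (k%:R + 1) - d / 2 = a + d * k%:R + d / 2 by field.
  by rewrite sinD sinB; ring.
rewrite -(big_mkord xpredT (fun k => F k.+1 - F k)) telescope_sumr// /F dn.
apply/eqP; rewrite subr_eq0; apply/eqP.
(* The two sines left by telescoping have arguments that differ by [m] full turns. *)
have -> : a + 2 * pi * m%:R - d / 2 = a + d * 0%:R - d / 2 + (pi *+ 2) *+ m.
  by ring.
elim: m {dn} => [|m IH]; first by rewrite mulr0n addr0.
by rewrite (mulrSr _ m) addrA [LHS]sinD sin2pi cos2pi mulr1 IH (mulr0 (cos _)) [LHS]addr0.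
Qed.

(** The [n] steps make [m] full turns, and [0 < m < n] keeps the half step [pi m / n] strictly
    between 0 and [pi], where the sine does not vanish. *)
Lemma sum_cos_multiple (R : realType) (a : R) (m n : nat) : (0 < m < n)%N ->
  \sum_(k < n) cos (a + 2 * pi * k%:R / n%:R *+ m) = 0.
Proof.
move=> /andP[m0 mn]; have n_gt0 : (0 < n)%N := ltn_trans m0 mn.
have n0 : 0 < n%:R :> R by rewrite ltr0n.
rewrite -[RHS](@sum_cos_period _ a (2 * pi * m%:R / n%:R) m n).
- by apply: eq_bigr => k _; congr (cos (_ + _)); ring.
- have -> : 2 * pi * m%:R / n%:R / 2 = pi * (m%:R / n%:R) :> R.
    by field; rewrite gt_eqF.
  rewrite sin_ltpi_neq0// mulr_gt0 ?divr_gt0 ?pi_gt0 ?ltr0n//=.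
  by rewrite gtr_pMr ?pi_gt0// ltr_pdivrMr// mul1r ltr_nat.
- by field; rewrite gt_eqF.
Qed.

(** The harmonics of orders 1 and 2 sum to zero, both orders being less than [n] since [n >= 3];
    only the constant term survives. *)
Lemma sum_trig_poly2 (R : realType) (n : nat) (A B C D E : R) : (3 <= n)%N ->
  let t k : R := 2 * pi * k%:R / n%:R in
  \sum_(k < n) (A + (B * cos (t k) + C * sin (t k)) +
                (D * cos (t k *+ 2) + E * sin (t k *+ 2))) = A *+ n.
Proof.
move=> n3 t.
have sumc m : (0 < m < n)%N -> \sum_(k < n) cos (t k *+ m) = 0.
  move=> mn; rewrite -[RHS](sum_cos_multiple 0 mn).
  by apply: eq_bigr => k _; rewrite add0r.
have sums m : (0 < m < n)%N -> \sum_(k < n) sin (t k *+ m) = 0.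
  move=> mn; apply: oppr_inj; rewrite oppr0.
  (* A phase of [pi / 2] turns cosines into opposite sines. *)
  rewrite -[RHS](sum_cos_multiple (pi / 2) mn) -sumrN.
  by apply: eq_bigr => k _; rewrite [pi / 2 + _]addrC cosDpihalf.
have n1 : (0 < 1 < n)%N by rewrite (ltn_trans _ n3).
rewrite !big_split/= -!mulr_sumr !sumc// !sums// (sumc 1%N)// (sums 1%N)//.
by rewrite !mulr0 !addr0 sumr_const card_ord.
Qed.

(* The first two moments of the squared distances are symmetric in the
   circumradius and the distance to the centroid. *)
Lemma sum_sqr_dist_regular_ngon (R : realType) (n : nat) (O M : R * R) (r : R)
    (P : set (R * R)) (A : 'I_n -> R * R) : (3 <= n)%N ->
  regular_ngon n O r P -> enumeration P A ->
  let S := euclid_dist M O ^+ 2 + r ^+ 2 in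
  \sum_(k < n) euclid_dist M (A k) ^+ 2 = S *+ n /\
  \sum_(k < n) (euclid_dist M (A k) ^+ 2) ^+ 2 =
    (S ^+ 2 + 2 * (euclid_dist M O ^+ 2 * r ^+ 2)) *+ n.
Proof.
move=> n3 [r0 [a Oa PE]] PA.
set A' := (fun k : 'I_n => _) in PE.
have PA' : enumeration P A'.
  by split; [exact: regular_rotation_inj r0 Oa | rewrite PE].
rewrite (sum_enumeration (fun x => euclid_dist M x ^+ 2) PA PA').
rewrite (sum_enumeration (fun x => (euclid_dist M x ^+ 2) ^+ 2) PA PA').
move: Oa => /(circleP _ _ (ltW r0)) ha.
rewrite [euclid_dist M O ^+ 2]sqr_euclid_dist -ha.
set v1 := a.1 - O.1; set v2 := a.2 - O.2.
set u1 := M.1 - O.1; set u2 := M.2 - O.2.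
(* These are the inner and cross products of [M - O] and [a - O], so that [p ^+ 2 + q ^+ 2] is the
   product of the squared lengths. The next equality is the law of cosines at [O]. *)
pose p := u1 * v1 + u2 * v2; pose q := u2 * v1 - u1 * v2.
have distE k : euclid_dist M (A' k) ^+ 2 =
    (u1 ^+ 2 + u2 ^+ 2) + (v1 ^+ 2 + v2 ^+ 2) +
    (- (2 * p) * cos (2 * pi * k%:R / n%:R) +
     - (2 * q) * sin (2 * pi * k%:R / n%:R)).
  rewrite sqr_euclid_dist /A' /rotation /= -/v1 -/v2.
  have := cos2Dsin2 (2 * pi * k%:R / n%:R : R).
  move: (cos _) (sin _) => c s cs.
  have -> : v1 ^+ 2 + v2 ^+ 2 = (c ^+ 2 + s ^+ 2) * (v1 ^+ 2 + v2 ^+ 2).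
    by rewrite cs mul1r.
  by rewrite /p /q /u1 /u2; ring.
rewrite /=; split.
  rewrite -(sum_trig_poly2 _ (- (2 * p)) (- (2 * q)) 0 0 n3).
  by apply: eq_bigr => k _; rewrite distE !mul0r !addr0.
set S := (_ + _ : R) in distE *.
(* These are the Fourier coefficients of the square of [S - 2 (p cos t + q sin t)]: by the double
   angle formulas, [4 (p cos t + q sin t)^2] equals [2 (p^2 + q^2) + 2 (p^2 - q^2) cos 2t + 4 p q
   sin 2t]. *)
rewrite -(sum_trig_poly2 _ (- (4 * S * p)) (- (4 * S * q))
  (2 * (p ^+ 2 - q ^+ 2)) (4 * p * q) n3).
apply: eq_bigr => k _; rewrite distE cos_mulr2n sin_mulr2n.
have -> : (u1 ^+ 2 + u2 ^+ 2) * (v1 ^+ 2 + v2 ^+ 2) = p ^+ 2 + q ^+ 2.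
  by rewrite /p /q; ring.
have := cos2Dsin2 (2 * pi * k%:R / n%:R : R).
move: (cos _) (sin _) => c s cs.
have -> : 2 * (p ^+ 2 + q ^+ 2) = 2 * (p ^+ 2 + q ^+ 2) * (c ^+ 2 + s ^+ 2).
  by rewrite cs mulr1.
have -> : c ^+ 2 *+ 2 - 1 = c ^+ 2 *+ 2 - (c ^+ 2 + s ^+ 2) by rewrite cs.
ring.
Qed.

(** * Equidistant points: where they lie and how to obtain them *)

Lemma equidistant_circles (R : realType) (n : nat) (O1 O2 M : R * R)
    (R1 R2 : R) (P1 P2 : set (R * R)) (A B : 'I_n -> R * R) :
  (3 <= n)%N -> R1 <> R2 ->
  regular_ngon n O1 R1 P1 -> regular_ngon n O2 R2 P2 ->
  enumeration P1 A -> enumeration P2 B ->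
  (forall k, euclid_dist M (A k) = euclid_dist M (B k)) ->
  (circle O2 R1 `&` circle O1 R2) M.
Proof.
move=> n3 R12 hP1 hP2 PA PB MAB.
have R10 : 0 <= R1 by apply: ltW; case: hP1.
have R20 : 0 <= R2 by apply: ltW; case: hP2.
have [A1 A2] := sum_sqr_dist_regular_ngon M n3 hP1 PA.
have [B1 B2] := sum_sqr_dist_regular_ngon M n3 hP2 PB.
have n_gt0 : (0 < n)%N := leq_trans (isT : (0 < 3)%N) n3.
have sumE F : \sum_(k < n) F (euclid_dist M (A k)) =
    \sum_(k < n) F (euclid_dist M (B k)) :> R.
  by apply: eq_bigr => k _; rewrite MAB.
move: A2; rewrite (sumE (fun x => (x ^+ 2) ^+ 2)) B2.
move: A1; rewrite (sumE (fun x => x ^+ 2)) B1.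
move=> /(pmulrnI n_gt0) sumsq /(pmulrnI n_gt0); rewrite sumsq => /addrI prodsq.
rewrite /circle/=.
have d10 := euclid_dist_ge0 M O1; have d20 := euclid_dist_ge0 M O2.
have sqr_inj (x y : R) : 0 <= x -> 0 <= y -> x ^+ 2 = y ^+ 2 -> x = y.
  by move=> x0 y0 /eqP; rewrite eqrXn2// => /eqP.
(* Equal sums and products make [MO_1^2] a root of [(x - MO_2^2) (x - R_2^2)]. The root [MO_2^2]
   would force [R1 = R2]. *)
have : (euclid_dist M O1 ^+ 2 - euclid_dist M O2 ^+ 2) *
       (euclid_dist M O1 ^+ 2 - R2 ^+ 2) = 0 by nra.
move=> /eqP; rewrite mulf_eq0 !subr_eq0 => /orP[] /eqP dE.
  by exfalso; apply: R12; apply: sqr_inj => //; lra.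
by split; apply: sqr_inj => //; lra.
Qed.

(** By (I), both squared distances have the constant part [R1 ^+ 2 + R2 ^+ 2], so only inner
    products remain to be matched. The vectors [(p, q)] and [(c, d)] built below both have length
    [R1 * R2]; [t] is the angle from [(c, d)] to [(p, q)]. *)
Lemma exists_rotation_equidistant (R : realType) (O1 O2 M a b : R * R)
    (R1 R2 : R) :
  0 < R1 -> 0 < R2 -> circle O1 R1 a -> circle O2 R2 b ->
  circle O2 R1 M -> circle O1 R2 M ->
  exists t, euclid_dist M (rotation O1 t a) = euclid_dist M b.
Proof.
move=> R10 R20 /(circleP _ _ (ltW R10)) ha /(circleP _ _ (ltW R20)) hb.
move=> /(circleP _ _ (ltW R10)) hM2 /(circleP _ _ (ltW R20)) hM1.
pose v1 := a.1 - O1.1; pose v2 := a.2 - O1.2.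
pose u1 := M.1 - O1.1; pose u2 := M.2 - O1.2.
pose w1 := b.1 - O2.1; pose w2 := b.2 - O2.2.
pose z1 := M.1 - O2.1; pose z2 := M.2 - O2.2.
rewrite -/v1 -/v2 in ha; rewrite -/u1 -/u2 in hM1.
rewrite -/w1 -/w2 in hb; rewrite -/z1 -/z2 in hM2.
pose p := u1 * v1 + u2 * v2; pose q := u2 * v1 - u1 * v2.
pose c := z1 * w1 + z2 * w2; pose d := z2 * w1 - z1 * w2.
have pq : p ^+ 2 + q ^+ 2 = R1 ^+ 2 * R2 ^+ 2.
  by rewrite -ha -hM1 /p /q; ring.
have cd : c ^+ 2 + d ^+ 2 = R1 ^+ 2 * R2 ^+ 2.
  by rewrite -hb -hM2 /c /d; ring.
have K0 : R1 ^+ 2 * R2 ^+ 2 != 0 by rewrite mulf_neq0// expf_neq0// gt_eqF.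
(* The wanted condition is [p cos t + q sin t = c]. *)
have [t [ct st]] : exists t, cos t = (c * p + d * q) / (R1 ^+ 2 * R2 ^+ 2) /\
                             sin t = (c * q - d * p) / (R1 ^+ 2 * R2 ^+ 2).
  apply: exists_angle; rewrite !exprMn -mulrDl exprVn.
  have -> : (c * p + d * q) ^+ 2 + (c * q - d * p) ^+ 2 =
    (c ^+ 2 + d ^+ 2) * (p ^+ 2 + q ^+ 2) by ring.
  by rewrite cd pq -expr2 divff// expf_neq0.
have ctst : p * cos t + q * sin t = c.
  have -> : p * cos t + q * sin t = c * (p ^+ 2 + q ^+ 2) / (R1 ^+ 2 * R2 ^+ 2).
    by rewrite ct st; ring.
  by rewrite pq mulfK.
exists t; apply: eq_euclid_dist => /=; rewrite -/v1 -/v2.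
transitivity (u1 ^+ 2 + u2 ^+ 2 +
    (cos t ^+ 2 + sin t ^+ 2) * (v1 ^+ 2 + v2 ^+ 2) -
    2 * (p * cos t + q * sin t)).
  by rewrite /p /q /u1 /u2; ring.
rewrite cos2Dsin2 mul1r hM1 ha ctst.
by rewrite -hb -hM2 /c /z1 /z2 /w1 /w2; ring.
Qed.

Lemma mem_regular_ngon (R : realType) (n : nat) (O : R * R) (r : R)
    (P : set (R * R)) : regular_ngon n O r P -> P `<=` circle O r.
Proof.
move=> [r0 [a Oa ->]] x [k _ <-].
exact: circle_rotation (ltW r0) Oa.
Qed.

(** An explicit position: [M] is the origin, the centroids lie on the first axis at distances [R2]
    and [R1] from it, and the polygons share the vertex [(R1 + R2, 0)]. The vertices at angle [t]
    from it are then both at squared distance [R1^2 + R2^2 + 2 R1 R2 cos t] from [M]. *)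
Lemma exists_equidistant (R : realType) (n : nat) (C1 C2 : R * R) (R1 R2 : R)
    (P1 P2 : set (R * R)) :
  regular_ngon n C1 R1 P1 -> regular_ngon n C2 R2 P2 ->
  exists (f g : R * R -> R * R) (M : R * R) (A B : 'I_n -> R * R),
    [/\ rigid_motion f, rigid_motion g,
        enumeration (f @` P1) A, enumeration (g @` P2) B &
        forall k, euclid_dist M (A k) = euclid_dist M (B k)].
Proof.
move=> [R10 [a Ca ->]] [R20 [b Cb ->]].
pose a' : R * R := (R1 + R2, 0).
pose O1 : R * R := (R2, 0); pose O2 : R * R := (R1, 0).
have Oa : circle O1 R1 a' by apply/circleP; rewrite ?ltW//=; ring.
have Ob : circle O2 R2 a' by apply/circleP; rewrite ?ltW//=; ring.
have [f rf fE] := exists_rigid_motion_rotation R10 Ca Oa.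
have [g rg gE] := exists_rigid_motion_rotation R20 Cb Ob.
exists f, g, (0, 0), (fun k => rotation O1 (2 * pi * k%:R / n%:R) a'),
  (fun k => rotation O2 (2 * pi * k%:R / n%:R) a'); split => //.
- split; first exact: regular_rotation_inj R10 Oa.
  by rewrite image_comp; apply: eq_imagel => k _ /=; rewrite fE.
- split; first exact: regular_rotation_inj R20 Ob.
  by rewrite image_comp; apply: eq_imagel => k _ /=; rewrite gE.
move=> k; apply: eq_euclid_dist => /=.
have := cos2Dsin2 (2 * pi * k%:R / n%:R : R).
move: (cos _) (sin _) => c s cs.
transitivity (R2 ^+ 2 + (c ^+ 2 + s ^+ 2) * R1 ^+ 2 + 2 * c * R1 * R2).
  by ring.
transitivity (R1 ^+ 2 + (c ^+ 2 + s ^+ 2) * R2 ^+ 2 + 2 * c * R1 * R2).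
  by rewrite cs; ring.
by ring.
Qed.

Theorem theorem4p1 (R : realType) (n : nat) (hn : (3 <= n)%N)
    (P1 P2 : set (R * R)) (C1 C2 : R * R) (R1 R2 : R)
    (hP1 : regular_ngon n C1 R1 P1) (hP2 : regular_ngon n C2 R2 P2)
    (hP12 : ~ congruent P1 P2) :
  (exists (f g : R * R -> R * R) (M : R * R) (A B : 'I_n -> R * R),
      [/\ rigid_motion f, rigid_motion g,
          enumeration (f @` P1) A, enumeration (g @` P2) B &
          forall k, euclid_dist M (A k) = euclid_dist M (B k)]) /\
  (forall (f g : R * R -> R * R) (O1 O2 M : R * R) (A B : 'I_n -> R * R),
      rigid_motion f -> rigid_motion g ->
      regular_ngon n O1 R1 (f @` P1) -> regular_ngon n O2 R2 (g @` P2) ->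
      enumeration (f @` P1) A -> enumeration (g @` P2) B ->
      ((forall k, euclid_dist M (A k) = euclid_dist M (B k)) ->
         (circle O2 R1 `&` circle O1 R2) M /\
         euclid_dist M (A (first_index hn)) =
           euclid_dist M (B (first_index hn))) /\
      ((circle O2 R1 `&` circle O1 R2) M ->
         (exists t : R, euclid_dist M (rotation O1 t (A (first_index hn))) =
                        euclid_dist M (B (first_index hn))) /\
         (exists t : R, euclid_dist M (A (first_index hn)) =
                        euclid_dist M (rotation O2 t (B (first_index hn)))))).
Proof.
split; first exact: exists_equidistant hP1 hP2.
move=> f g O1 O2 M A B _ _ hO1 hO2 PA PB; split.
  move=> MAB; split => //.
  have R12 := noncongruent_circumradii hP1 hP2 hP12.
  exact: equidistant_circles hn R12 hO1 hO2 PA PB MAB.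
move=> [MO2 MO1]; have [[R10 _] [R20 _]] := (hO1, hO2).
set i := first_index hn.
have Ai : circle O1 R1 (A i).
  by apply: (mem_regular_ngon hO1); case: PA => _ <-; exists i.
have Bi : circle O2 R2 (B i).
  by apply: (mem_regular_ngon hO2); case: PB => _ <-; exists i.
split; first exact: exists_rotation_equidistant R10 R20 Ai Bi MO2 MO1.
(* Exchanging the two polygons yields the rotation about [O2]. *)
have [t MBA] := exists_rotation_equidistant R20 R10 Bi Ai MO1 MO2.
by exists t.
Qed.
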